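(* Let $\mathbb A$ be a distributive monoidal category, with free cornering with choice $\ulcorner\mathbb A\urcorner^{\oplus}$ and crossing cells $\chi_{U,A}:(U;A;A;U)$ in it. For all $U\in\mathbb A^{\circ\bullet}_\oplus$ and $A,B\in\mathbb A_0$: (i) $\chi_{U,A\otimes B}=\chi_{U,A}\mid\chi_{U,B}$; (ii) $\chi_{U,I}=id_U$.
   Context: Monoidal categories are strict, and composites are in diagrammatic order ($fg$ is first $f$, then $g$). $\sigma_{A,B}:A\otimes B\to B\otimes A$ is the braiding. A single-object double category $\mathbb D$ has a horizontal edge monoid $(\mathbb D_H,\otimes,I)$, a vertical edge monoid $(\mathbb D_V,\otimes,I)$, and for $A,B\in\mathbb D_H$, $U,W\in\mathbb D_V$ a set of cells $(U;A;B;W)$ (left; top; bottom; right boundary). For $\alpha:(U;A;B;V)$ and $\beta:(V;A';B';W)$ there is a horizontal composite $\alpha\mid\beta:(U;A\otimes A';B\otimes B';W)$; for $\alpha:(U;A;C;W)$ and $\beta:(U';C;B;W')$ a vertical composite $\frac{\alpha}{\beta}:(U\otimes U';A;B;W\otimes W')$. Both are associative and unital, with horizontal units $id_U:(U;I;I;U)$ and vertical units $1_A:(I;A;A;I)$, where $id_I=1_I$, $1_{A\otimes B}=1_A\mid 1_B$, $id_{U\otimes W}=\frac{id_U}{id_W}$, and interchange $\frac{\alpha}{\beta}\mid\frac{\gamma}{\delta}=\frac{\alpha\mid\gamma}{\beta\mid\delta}$ holds. A distributive monoidal category $(\mathbb A,\otimes,\oplus,I)$ is a symmetric monoidal category with binary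 coproducts $A\oplus B$ (injections $\sigma_0,\sigma_1$, copairing $[f,g]$; no initial object required) such that $[\sigma_0\otimes 1_C,\sigma_1\otimes 1_C]:(A\otimes C)\oplus(B\otimes C)\to(A\oplus B)\otimes C$ is invertible for all $A,B,C$. Exchanges with choice: $\mathbb A^{\circ\bullet}_\oplus$ is the monoid (operation $\otimes$, unit $I$) with elements generated by $A^\circ$, $A^\bullet$ ($A\in\mathbb A_0$), $I$, $U\otimes W$, $U\times W$, $U+W$, subject only to associativity and unitality of $\otimes$. Free cornering with choice: $\ulcorner\mathbb A\urcorner^{\oplus}$ is the free single-object double category with horizontal edge monoid $(\mathbb A_0,\otimes,I)$, vertical edge monoid $\mathbb A^{\circ\bullet}_\oplus$, and generating cells and equations: (1) for each $f:A\to B$ in $\mathbb A$ a cell $\ulcorner f\urcorner:(I;A;B;I)$ (also written $f$), with $\ulcorner fg\urcorner=\frac{\ulcorner f\urcorner}{\ulcorner g\urcorner}$, $\ulcorner 1_A\urcorner=1_A$, $\ulcorner f\otimes g\urcorner=\ulcorner f\urcorner\mid\ulcorner g\urcorner$; (2) for each $A\in\mathbb A_0$ corner cells $\mathsf{get}_L^A:(A^\circ;I;A;I)$, $\mathsf{put}_R^A:(I;A;I;A^\circ)$, $\mathsf{get}_R^A:(I;I;A;A^\bullet)$, $\mathsf{put}_L^A:(A^\bullet;A;I;I)$ with $\mathsf{put}_R^A\mid\mathsf{get}_L^A=1_A$, $\frac{\mathsf{get}_L^A}{\mathsf{put}_R^A}=id_{A^\circ}$, $\mathsf{get}_R^A\mid\mathsf{put}_L^A=1_A$,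 $\frac{\mathsf{get}_R^A}{\mathsf{put}_L^A}=id_{A^\bullet}$; (3) for all $U,W$, cells $\pi_0:(U\times W;I;I;U)$, $\pi_1:(U\times W;I;I;W)$, and for $\alpha:(V;A;B;U)$, $\beta:(V;A;B;W)$ a unique cell $\alpha\times\beta:(V;A;B;U\times W)$ with $(\alpha\times\beta)\mid\pi_0=\alpha$, $(\alpha\times\beta)\mid\pi_1=\beta$; (4) for all $U,W$, cells $\iota_0:(U;I;I;U+W)$, $\iota_1:(W;I;I;U+W)$, and for $\alpha:(U;A;B;V)$, $\beta:(W;A;B;V)$ a unique cell $\alpha+\beta:(U+W;A;B;V)$ with $\iota_0\mid(\alpha+\beta)=\alpha$, $\iota_1\mid(\alpha+\beta)=\beta$; (5) for $\alpha:(U;A;C;W)$, $\beta:(U;B;C;W)$ a unique cell $[\alpha,\beta]:(U;A\oplus B;C;W)$ with $\frac{\ulcorner\sigma_0\urcorner}{[\alpha,\beta]}=\alpha$, $\frac{\ulcorner\sigma_1\urcorner}{[\alpha,\beta]}=\beta$. Crossing cells $\chi_{U,B}:(U;B;B;U)$, by induction on $U$: $\chi_{A^\circ,B}$ is the vertical composite (top to bottom) of $\mathsf{get}_L^A\mid 1_B$, $\sigma_{A,B}$, $1_B\mid\mathsf{put}_R^A$; $\chi_{A^\bullet,B}$ is the vertical composite (top to bottom) of $1_B\mid\mathsf{get}_R^A$, $\sigma_{B,A}$, $\mathsf{put}_L^A\mid 1_B$; $\chi_{I,B}=1_B$; $\chi_{U\otimes W,B}=\frac{\chi_{U,B}}{\chi_{W,B}}$;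 $\chi_{U+W,B}=(\chi_{U,B}\mid\iota_0)+(\chi_{W,B}\mid\iota_1)$; $\chi_{U\times W,B}=(\pi_0\mid\chi_{U,B})\times(\pi_1\mid\chi_{W,B})$. *)

(* Defs.v *)
From mathcomp Require Import all_boot generic_quotient.
From mathcomp Require Import boolp.

Set Implicit Arguments.
Unset Strict Implicit.
Unset Printing Implicit Defensive.

Declare Scope mon_scope.
Delimit Scope mon_scope with mon.
Local Open Scope quotient_scope.
Local Open Scope mon_scope.

(* MathComp's [monoidType] requires a [choiceType] carrier; edge monoids are
   arbitrary monoids. *)
Record monoid := Monoid {
  msort :> Type;
  mmul : msort -> msort -> msort;
  mone : msort;
  mmulA : associative mmul;
  mmul1 : left_id mone mmul;
  mmulr1 : right_id mone mmul }.

Arguments mmul {_} _ _.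
Arguments mone {_}.
Arguments mmulA {_} _ _ _.
Arguments mmul1 {_} _.
Arguments mmulr1 {_} _.

Notation "A \ox B" := (mmul A B) (at level 40, left associativity) : mon_scope.
Notation "\I" := mone (at level 0) : mon_scope.

(* Strict associativity and unitality hold only propositionally at the level of
   objects, so the two sides of a law may live in different fibres of a family.
   [f =~h g] (arrows) and [a =~ b] (cells) say that the indices agree and that,
   along these identifications, the elements agree. *)
Inductive hom_eq (O : Type) (hom : O -> O -> Type) (A B : O) (f : hom A B) :
    forall A' B', hom A' B' -> Prop :=
  HomEq : hom_eq f f.

Inductive cell_eq (V H : Type) (cell : V -> H -> H -> V -> Type)
    (U : V) (A B : H) (W : V) (a : cell U A B W) :
    forall U' A' B' W', cell U' A' B' W' -> Prop :=
  CellEq : cell_eq a a.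

Notation "f =~h g" := (hom_eq f g) (at level 70) : mon_scope.
Notation "a =~ b" := (cell_eq a b) (at level 70) : mon_scope.

Definition hom_cast (O : Type) (hom : O -> O -> Type) (A A' B B' : O)
    (eA : A = A') (eB : B = B') (f : hom A B) : hom A' B' :=
  match eA in _ = X, eB in _ = Y return hom X Y with
  | erefl, erefl => f
  end.

(* Composition [comp f g] is in diagrammatic order. *)
Record strict_smc := StrictSMC {
  ob :> monoid;
  hom : ob -> ob -> Type;
  idm : forall A, hom A A;
  comp : forall A B C, hom A B -> hom B C -> hom A C;
  comp1m : forall A B (f : hom A B), comp (idm A) f = f;
  compm1 : forall A B (f : hom A B), comp f (idm B) = f;
  compA : forall A B C D (f : hom A B) (g : hom B C) (h : hom C D),
    comp f (comp g h) = comp (comp f g) h;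
  tens : forall A B A' B', hom A B -> hom A' B' -> hom (A \ox A') (B \ox B');
  tens_id : forall A B, tens (idm A) (idm B) = idm (A \ox B);
  tens_comp : forall A B C A' B' C' (f : hom A B) (g : hom B C)
      (f' : hom A' B') (g' : hom B' C'),
    tens (comp f g) (comp f' g') = comp (tens f f') (tens g g');
  tensA : forall A B A' B' A'' B''
      (f : hom A B) (g : hom A' B') (h : hom A'' B''),
    tens f (tens g h) =~h tens (tens f g) h;
  tens1m : forall A B (f : hom A B), tens (idm \I) f =~h f;
  tensm1 : forall A B (f : hom A B), tens f (idm \I) =~h f;
  braid : forall A B, hom (A \ox B) (B \ox A);
  braid_nat : forall A B A' B' (f : hom A B) (g : hom A' B'),
    comp (tens f g) (braid B B') = comp (braid A A') (tens g f);
  braid_sym : forall A B, comp (braid A B) (braid B A) = idm (A \ox B);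
  braid_hexagon : forall A B C,
    braid A (B \ox C) =~h
    comp (tens (braid A B) (idm C))
         (hom_cast (mmulA B A C) (mmulA B C A) (tens (idm B) (braid A C))) }.

Arguments hom {_} _ _.
Arguments idm {_} A.
Arguments braid {_} A B.

Record distr_moncat := DistrMoncat {
  smc :> strict_smc;
  oplus : smc -> smc -> smc;
  inj0 : forall A B, hom A (oplus A B);
  inj1 : forall A B, hom B (oplus A B);
  copair : forall A B C, hom A C -> hom B C -> hom (oplus A B) C;
  copair0 : forall A B C (f : hom A C) (g : hom B C),
    comp (inj0 A B) (copair f g) = f;
  copair1 : forall A B C (f : hom A C) (g : hom B C),
    comp (inj1 A B) (copair f g) = g;
  copair_uniq : forall A B C (f : hom A C) (g : hom B C)
      (h : hom (oplus A B) C),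
    comp (inj0 A B) h = f -> comp (inj1 A B) h = g -> h = copair f g;
  distributive : forall A B C,
    let d : hom (oplus (A \ox C) (B \ox C)) (oplus A B \ox C) :=
      copair (tens (inj0 A B) (idm C)) (tens (inj1 A B) (idm C)) in
    exists e : hom (oplus A B \ox C) (oplus (A \ox C) (B \ox C)),
      comp d e = idm _ /\ comp e d = idm _ }.

Arguments oplus {_} A B.
Arguments inj0 {_} A B.
Arguments inj1 {_} A B.

(* [cell U A B W]: left, top, bottom, right boundary. *)
Record double_cat (H V : monoid) := DoubleCat {
  cell :> V -> H -> H -> V -> Type;
  hcomp : forall U A B V' A' B' W,
    cell U A B V' -> cell V' A' B' W -> cell U (A \ox A') (B \ox B') W;
  vcomp : forall U A C W U' B W',
    cell U A C W -> cell U' C B W' -> cell (U \ox U') A B (W \ox W');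
  hid : forall U, cell U \I \I U;
  vid : forall A, cell \I A A \I;
  hcompA : forall U0 U1 U2 U3 A0 A1 A2 B0 B1 B2
      (a : cell U0 A0 B0 U1) (b : cell U1 A1 B1 U2) (c : cell U2 A2 B2 U3),
    hcomp a (hcomp b c) =~ hcomp (hcomp a b) c;
  hcomp1c : forall U A B W (a : cell U A B W), hcomp (hid U) a =~ a;
  hcompc1 : forall U A B W (a : cell U A B W), hcomp a (hid W) =~ a;
  vcompA : forall A0 A1 A2 A3 U0 U1 U2 W0 W1 W2
      (a : cell U0 A0 A1 W0) (b : cell U1 A1 A2 W1) (c : cell U2 A2 A3 W2),
    vcomp a (vcomp b c) =~ vcomp (vcomp a b) c;
  vcomp1c : forall U A B W (a : cell U A B W), vcomp (vid A) a =~ a;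
  vcompc1 : forall U A B W (a : cell U A B W), vcomp a (vid B) =~ a;
  hid_one : hid \I = vid \I;
  vid_mul : forall A B, vid (A \ox B) = hcomp (vid A) (vid B);
  hid_mul : forall U W, hid (U \ox W) = vcomp (hid U) (hid W);
  interchange : forall U A C V' U' B W' A' C' B' W W''
      (a : cell U A C V') (b : cell U' C B W')
      (c : cell V' A' C' W) (d : cell W' C' B' W''),
    hcomp (vcomp a b) (vcomp c d) = vcomp (hcomp a c) (hcomp b d) }.

Arguments hid {_ _} _ U.
Arguments vid {_ _} _ A.

Definition hcast (H V : monoid) (D : double_cat H V) (U : V) (A A' B B' : H)
    (W : V) (eA : A = A') (eB : B = B') (a : D U A B W) : D U A' B' W :=
  hom_cast (hom := fun X Y => D U X Y W) eA eB a.

(* The monoid generated by A°, A•, I, U ⊗ W, U × W, U + W subject only to the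
   monoid laws for ⊗ is the free monoid on the letters A°, A•, U × W, U + W,
   where U and W are again words; ⊗ is concatenation and I the empty word. *)
Inductive letter (O : Type) : Type :=
  | circ of O
  | bullet of O
  | ltimes of seq (letter O) & seq (letter O)
  | lplus of seq (letter O) & seq (letter O).

Definition exch (O : Type) : monoid :=
  @Monoid (seq (letter O)) cat [::] (@catA _) (@cat0s _) (@cats0 _).

Definition xcirc (O : Type) (A : O) : exch O := [:: circ A].
Definition xbullet (O : Type) (A : O) : exch O := [:: bullet A].
Definition xtimes (O : Type) (U W : exch O) : exch O := [:: ltimes U W].
Definition xplus (O : Type) (U W : exch O) : exch O := [:: lplus U W].

(* Single-object double categories carrying the generating cells and satisfying
   the equations of the free cornering with choice. *)
Record cornering (M : distr_moncat) := Cornering {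
  dcat :> double_cat (ob M) (exch M);

  emb : forall A B : M, hom A B -> dcat \I A B \I;
  emb_comp : forall (A B C : M) (f : hom A B) (g : hom B C),
    emb (comp f g) =~ vcomp (emb f) (emb g);
  emb_id : forall A : M, emb (idm A) = vid dcat A;
  emb_tens : forall (A B A' B' : M) (f : hom A B) (g : hom A' B'),
    emb (tens f g) = hcomp (emb f) (emb g);

  getL : forall A : M, dcat (xcirc A) \I A \I;
  putR : forall A : M, dcat \I A \I (xcirc A);
  getR : forall A : M, dcat \I \I A (xbullet A);
  putL : forall A : M, dcat (xbullet A) A \I \I;
  putR_getL_h : forall A : M, hcomp (putR A) (getL A) =~ vid dcat A;
  getL_putR_v : forall A : M,
    vcomp (getL A) (putR A) =~ hid dcat (xcirc A);
  getR_putL_h : forall A : M, hcomp (getR A) (putL A) =~ vid dcat A;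
  getR_putL_v : forall A : M,
    vcomp (getR A) (putL A) =~ hid dcat (xbullet A);

  pi0 : forall U W : exch M, dcat (xtimes U W) \I \I U;
  pi1 : forall U W : exch M, dcat (xtimes U W) \I \I W;
  cpair : forall (V U W : exch M) (A B : M),
    dcat V A B U -> dcat V A B W -> dcat V A B (xtimes U W);
  cpair0 : forall (V U W : exch M) (A B : M)
      (a : dcat V A B U) (b : dcat V A B W), hcomp (cpair a b) (pi0 U W) =~ a;
  cpair1 : forall (V U W : exch M) (A B : M)
      (a : dcat V A B U) (b : dcat V A B W), hcomp (cpair a b) (pi1 U W) =~ b;
  cpair_uniq : forall (V U W : exch M) (A B : M)
      (a : dcat V A B U) (b : dcat V A B W) (c : dcat V A B (xtimes U W)),
    hcomp c (pi0 U W) =~ a -> hcomp c (pi1 U W) =~ b -> c = cpair a b;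

  inn0 : forall U W : exch M, dcat U \I \I (xplus U W);
  inn1 : forall U W : exch M, dcat W \I \I (xplus U W);
  cchoice : forall (U W V : exch M) (A B : M),
    dcat U A B V -> dcat W A B V -> dcat (xplus U W) A B V;
  cchoice0 : forall (U W V : exch M) (A B : M)
      (a : dcat U A B V) (b : dcat W A B V),
    hcomp (inn0 U W) (cchoice a b) =~ a;
  cchoice1 : forall (U W V : exch M) (A B : M)
      (a : dcat U A B V) (b : dcat W A B V),
    hcomp (inn1 U W) (cchoice a b) =~ b;
  cchoice_uniq : forall (U W V : exch M) (A B : M)
      (a : dcat U A B V) (b : dcat W A B V) (c : dcat (xplus U W) A B V),
    hcomp (inn0 U W) c =~ a -> hcomp (inn1 U W) c =~ b -> c = cchoice a b;

  cocase : forall (U W : exch M) (A B C : M),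
    dcat U A C W -> dcat U B C W -> dcat U (oplus A B) C W;
  cocase0 : forall (U W : exch M) (A B C : M)
      (a : dcat U A C W) (b : dcat U B C W),
    vcomp (emb (inj0 A B)) (cocase a b) =~ a;
  cocase1 : forall (U W : exch M) (A B C : M)
      (a : dcat U A C W) (b : dcat U B C W),
    vcomp (emb (inj1 A B)) (cocase a b) =~ b;
  cocase_uniq : forall (U W : exch M) (A B C : M)
      (a : dcat U A C W) (b : dcat U B C W) (c : dcat U (oplus A B) C W),
    vcomp (emb (inj0 A B)) c =~ a -> vcomp (emb (inj1 A B)) c =~ b ->
    c = cocase a b }.

Arguments emb {_} _ {_ _} _.
Arguments getL {_} _ A.
Arguments putR {_} _ A.
Arguments getR {_} _ A.
Arguments putL {_} _ A.
Arguments pi0 {_} _ U W.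
Arguments pi1 {_} _ U W.
Arguments inn0 {_} _ U W.
Arguments inn1 {_} _ U W.

Record cornering_hom (M : distr_moncat) (C D : cornering M) := CorneringHom {
  chom :> forall U A B W, C U A B W -> D U A B W;
  chom_hcomp : forall U A B V A' B' W (a : C U A B V) (b : C V A' B' W),
    chom (hcomp a b) = hcomp (chom a) (chom b);
  chom_vcomp : forall U A E W U' B W' (a : C U A E W) (b : C U' E B W'),
    chom (vcomp a b) = vcomp (chom a) (chom b);
  chom_hid : forall U, chom (hid C U) = hid D U;
  chom_vid : forall A, chom (vid C A) = vid D A;
  chom_emb : forall (A B : M) (f : hom A B), chom (emb C f) = emb D f;
  chom_getL : forall A, chom (getL C A) = getL D A;
  chom_putR : forall A, chom (putR C A) = putR D A;
  chom_getR : forall A, chom (getR C A) = getR D A;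
  chom_putL : forall A, chom (putL C A) = putL D A;
  chom_pi0 : forall U W, chom (pi0 C U W) = pi0 D U W;
  chom_pi1 : forall U W, chom (pi1 C U W) = pi1 D U W;
  chom_cpair : forall V U W A B (a : C V A B U) (b : C V A B W),
    chom (cpair a b) = cpair (chom a) (chom b);
  chom_inn0 : forall U W, chom (inn0 C U W) = inn0 D U W;
  chom_inn1 : forall U W, chom (inn1 C U W) = inn1 D U W;
  chom_cchoice : forall U W V A B (a : C U A B V) (b : C W A B V),
    chom (cchoice a b) = cchoice (chom a) (chom b);
  chom_cocase : forall U W A B E (a : C U A E W) (b : C U B E W),
    chom (cocase a b) = cocase (chom a) (chom b) }.

Section CellEqTheory.
Variables (V H : Type) (cell : V -> H -> H -> V -> Type).

Lemma cell_eq_eq U A B W (a b : cell U A B W) : a =~ b -> a = b.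
Proof.
suff gen U' A' B' W' (c : cell U' A' B' W') : a =~ c ->
    forall (eU : U' = U) (eA : A' = A) (eB : B' = B) (eW : W' = W),
    match eU in _ = u, eA in _ = x, eB in _ = y, eW in _ = w
      return cell u x y w with erefl, erefl, erefl, erefl => c end = a.
  by move=> /gen/(_ erefl erefl erefl erefl).
case=> eU eA eB eW.
by rewrite (Prop_irrelevance eU erefl) (Prop_irrelevance eA erefl)
  (Prop_irrelevance eB erefl) (Prop_irrelevance eW erefl).
Qed.

End CellEqTheory.

(* The free cornering: formal composites of generating cells, modulo the
   equations that hold in every cornering.  [free_cornering_initial] below is
   its universal property. *)
Section Free.
Variable M : distr_moncat.

Inductive term : exch M -> M -> M -> exch M -> Type :=
  | Thcomp U A B V A' B' W of term U A B V & term V A' B' W :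
      term U (A \ox A') (B \ox B') W
  | Tvcomp U A C W U' B W' of term U A C W & term U' C B W' :
      term (U \ox U') A B (W \ox W')
  | Thid U : term U \I \I U
  | Tvid A : term \I A A \I
  | Temb (A B : M) of hom A B : term \I A B \I
  | TgetL A : term (xcirc A) \I A \I
  | TputR A : term \I A \I (xcirc A)
  | TgetR A : term \I \I A (xbullet A)
  | TputL A : term (xbullet A) A \I \I
  | Tpi0 U W : term (xtimes U W) \I \I U
  | Tpi1 U W : term (xtimes U W) \I \I W
  | Tpair V U W A B of term V A B U & term V A B W : term V A B (xtimes U W)
  | Tinn0 U W : term U \I \I (xplus U W)
  | Tinn1 U W : term W \I \I (xplus U W)
  | Tchoice U W V A B of term U A B V & term W A B V : term (xplus U W) A B V
  | Tcocase U W A B C of term U A C W & term U B C W :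
      term U (oplus A B) C W.

Fixpoint eval (C : cornering M) U A B W (t : term U A B W) : C U A B W :=
  match t in term U A B W return C U A B W with
  | Thcomp _ _ _ _ _ _ _ t s => hcomp (eval C t) (eval C s)
  | Tvcomp _ _ _ _ _ _ _ t s => vcomp (eval C t) (eval C s)
  | Thid U => hid C U
  | Tvid A => vid C A
  | Temb _ _ f => emb C f
  | TgetL A => getL C A
  | TputR A => putR C A
  | TgetR A => getR C A
  | TputL A => putL C A
  | Tpi0 U W => pi0 C U W
  | Tpi1 U W => pi1 C U W
  | Tpair _ _ _ _ _ t s => cpair (eval C t) (eval C s)
  | Tinn0 U W => inn0 C U W
  | Tinn1 U W => inn1 C U W
  | Tchoice _ _ _ _ _ t s => cchoice (eval C t) (eval C s)
  | Tcocase _ _ _ _ _ t s => cocase (eval C t) (eval C s)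
  end.

Definition term_eq U A B W (t s : {classic term U A B W}) : bool :=
  `[< forall C : cornering M, eval C t = eval C s >].

Lemma term_eq_refl U A B W : reflexive (@term_eq U A B W).
Proof. by move=> t; apply/asboolP. Qed.
Lemma term_eq_sym U A B W : symmetric (@term_eq U A B W).
Proof. by move=> t s; apply/asboolP/asboolP => e C; rewrite e. Qed.
Lemma term_eq_trans U A B W : transitive (@term_eq U A B W).
Proof.
by move=> s t r /asboolP e /asboolP e'; apply/asboolP => C; rewrite e e'.
Qed.

Canonical term_equiv U A B W :=
  EquivRel (@term_eq U A B W) (@term_eq_refl U A B W) (@term_eq_sym U A B W)
    (@term_eq_trans U A B W).

Definition fcell U A B W : Type := {eq_quot @term_equiv U A B W}.

Definition cls U A B W (t : term U A B W) : fcell U A B W :=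
  \pi_({eq_quot @term_equiv U A B W}) (t : {classic term U A B W}).

Definition rep U A B W (a : fcell U A B W) : term U A B W :=
  repr (a : {eq_quot @term_equiv U A B W}).

Definition feval (C : cornering M) U A B W (a : fcell U A B W) : C U A B W :=
  eval C (rep a).

Lemma fcellP U A B W (a b : fcell U A B W) :
  (forall C, feval C a = feval C b) -> a = b.
Proof.
move=> e; rewrite -[a]reprK -[b]reprK.
by apply/eqquotP/asboolP.
Qed.

Lemma feval_cls C U A B W (t : term U A B W) : feval C (cls t) = eval C t.
Proof.
have /eqquotP/asboolP : cls (rep (cls t)) = cls t by apply: reprK.
exact.
Qed.

Lemma feval_eq C U A B W U' A' B' W' (a : fcell U A B W)
    (b : fcell U' A' B' W') : a =~ b -> feval C a =~ feval C b.
Proof. by case. Qed.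

Lemma fcell_eqP U A B W U' A' B' W' (a : fcell U A B W)
    (b : fcell U' A' B' W') : U = U' -> A = A' -> B = B' -> W = W' ->
  (forall C, feval C a =~ feval C b) -> a =~ b.
Proof.
move=> eU eA eB eW; case: _ / eU b => b; case: _ / eA b => b.
case: _ / eB b => b; case: _ / eW b => b e.
by rewrite (@fcellP _ _ _ _ a b) // => C; apply: cell_eq_eq.
Qed.

Lemma feval_Thcomp C U A B V A' B' W (a : fcell U A B V)
    (b : fcell V A' B' W) :
  feval C (cls (Thcomp (rep a) (rep b))) = hcomp (feval C a) (feval C b).
Proof. exact: feval_cls. Qed.

Lemma feval_Tvcomp C U A E W U' B W' (a : fcell U A E W)
    (b : fcell U' E B W') :
  feval C (cls (Tvcomp (rep a) (rep b))) = vcomp (feval C a) (feval C b).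
Proof. exact: feval_cls. Qed.

Lemma feval_Tpair C V U W A B (a : fcell V A B U) (b : fcell V A B W) :
  feval C (cls (Tpair (rep a) (rep b))) = cpair (feval C a) (feval C b).
Proof. exact: feval_cls. Qed.

Lemma feval_Tchoice C U W V A B (a : fcell U A B V) (b : fcell W A B V) :
  feval C (cls (Tchoice (rep a) (rep b))) = cchoice (feval C a) (feval C b).
Proof. exact: feval_cls. Qed.

Lemma feval_Tcocase C U W A B E (a : fcell U A E W) (b : fcell U B E W) :
  feval C (cls (Tcocase (rep a) (rep b))) = cocase (feval C a) (feval C b).
Proof. exact: feval_cls. Qed.

Definition fevalE :=
  (feval_Thcomp, feval_Tvcomp, feval_Tpair, feval_Tchoice, feval_Tcocase,
   feval_cls).

Definition free_double_cat : double_cat (ob M) (exch M).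
Proof.
refine (@DoubleCat (ob M) (exch M) fcell
  (fun _ _ _ _ _ _ _ a b => cls (Thcomp (rep a) (rep b)))
  (fun _ _ _ _ _ _ _ a b => cls (Tvcomp (rep a) (rep b)))
  (fun U => cls (Thid U)) (fun A => cls (Tvid A))
  _ _ _ _ _ _ _ _ _ _).
- move=> *; apply: fcell_eqP => [||||C]; rewrite ?fevalE ?mmulA //.
  exact: hcompA.
- move=> *; apply: fcell_eqP => [||||C]; rewrite ?fevalE ?mmul1 //.
  exact: hcomp1c.
- move=> *; apply: fcell_eqP => [||||C]; rewrite ?fevalE ?mmulr1 //.
  exact: hcompc1.
- move=> *; apply: fcell_eqP => [||||C]; rewrite ?fevalE ?mmulA //.
  exact: vcompA.
- move=> *; apply: fcell_eqP => [||||C]; rewrite ?fevalE ?mmul1 //.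
  exact: vcomp1c.
- move=> *; apply: fcell_eqP => [||||C]; rewrite ?fevalE ?mmulr1 //.
  exact: vcompc1.
- by apply: fcellP => C; rewrite !fevalE; exact: hid_one.
- by move=> *; apply: fcellP => C; rewrite !fevalE; exact: vid_mul.
- by move=> *; apply: fcellP => C; rewrite !fevalE; exact: hid_mul.
- by move=> *; apply: fcellP => C; rewrite !fevalE; exact: interchange.
Defined.

Lemma feval_hcomp C U A B V A' B' W (a : free_double_cat U A B V)
    (b : free_double_cat V A' B' W) :
  feval C (hcomp a b) = hcomp (feval C a) (feval C b).
Proof. exact: feval_cls. Qed.

Lemma feval_vcomp C U A E W U' B W' (a : free_double_cat U A E W)
    (b : free_double_cat U' E B W') :
  feval C (vcomp a b) = vcomp (feval C a) (feval C b).
Proof. exact: feval_cls. Qed.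

Lemma feval_hid C U : feval C (hid free_double_cat U) = hid C U.
Proof. exact: feval_cls. Qed.

Lemma feval_vid C A : feval C (vid free_double_cat A) = vid C A.
Proof. exact: feval_cls. Qed.

Definition fevalDE := (feval_hcomp, feval_vcomp, feval_hid, feval_vid, fevalE).

Definition free_cornering : cornering M.
Proof.
refine (@Cornering M free_double_cat
  (fun _ _ f => cls (Temb f)) _ _ _
  (fun A => cls (TgetL A)) (fun A => cls (TputR A))
  (fun A => cls (TgetR A)) (fun A => cls (TputL A)) _ _ _ _
  (fun U W => cls (Tpi0 U W)) (fun U W => cls (Tpi1 U W))
  (fun _ _ _ _ _ a b => cls (Tpair (rep a) (rep b))) _ _ _
  (fun U W => cls (Tinn0 U W)) (fun U W => cls (Tinn1 U W))
  (fun _ _ _ _ _ a b => cls (Tchoice (rep a) (rep b))) _ _ _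
  (fun _ _ _ _ _ a b => cls (Tcocase (rep a) (rep b))) _ _ _); cbv beta.
- move=> *; apply: fcell_eqP => [||||C]; rewrite ?fevalDE //; exact: emb_comp.
- move=> *; apply: fcellP => C; rewrite !fevalDE; exact: emb_id.
- move=> *; apply: fcellP => C; rewrite !fevalDE; exact: emb_tens.
- move=> *; apply: fcell_eqP => [||||C]; rewrite ?fevalDE ?mmulr1 ?mmul1 //.
  exact: putR_getL_h.
- move=> *; apply: fcell_eqP => [||||C]; rewrite ?fevalDE //.
  exact: getL_putR_v.
- move=> *; apply: fcell_eqP => [||||C]; rewrite ?fevalDE ?mmulr1 ?mmul1 //.
  exact: getR_putL_h.
- move=> *; apply: fcell_eqP => [||||C]; rewrite ?fevalDE //.
  exact: getR_putL_v.
- move=> *; apply: fcell_eqP => [||||C]; rewrite ?fevalDE ?mmulr1 ?mmul1 //.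
  exact: cpair0.
- move=> *; apply: fcell_eqP => [||||C]; rewrite ?fevalDE ?mmulr1 ?mmul1 //.
  exact: cpair1.
- move=> V U W A B a b c ea eb; apply: fcellP => C; rewrite !fevalDE.
  by apply: cpair_uniq;
    [move: (feval_eq C ea) | move: (feval_eq C eb)]; rewrite !fevalDE.
- move=> *; apply: fcell_eqP => [||||C]; rewrite ?fevalDE ?mmulr1 ?mmul1 //.
  exact: cchoice0.
- move=> *; apply: fcell_eqP => [||||C]; rewrite ?fevalDE ?mmulr1 ?mmul1 //.
  exact: cchoice1.
- move=> U W V A B a b c ea eb; apply: fcellP => C; rewrite !fevalDE.
  by apply: cchoice_uniq;
    [move: (feval_eq C ea) | move: (feval_eq C eb)]; rewrite !fevalDE.
- move=> *; apply: fcell_eqP => [||||C]; rewrite ?fevalDE ?mmulr1 ?mmul1 //.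
  exact: cocase0.
- move=> *; apply: fcell_eqP => [||||C]; rewrite ?fevalDE ?mmulr1 ?mmul1 //.
  exact: cocase1.
- move=> U W A B E a b c ea eb; apply: fcellP => C; rewrite !fevalDE.
  by apply: cocase_uniq;
    [move: (feval_eq C ea) | move: (feval_eq C eb)]; rewrite !fevalDE.
Defined.

Definition free_hom (C : cornering M) : cornering_hom free_cornering C.
Proof.
by refine (@CorneringHom M free_cornering C (feval C)
  _ _ _ _ _ _ _ _ _ _ _ _ _ _ _ _); move=> *; rewrite fevalE.
Defined.

Lemma free_hom_uniq (C : cornering M) (F : cornering_hom free_cornering C) :
  forall U A B W (a : free_cornering U A B W),
  F _ _ _ _ a = free_hom C _ _ _ _ a.
Proof.
move=> U A B W a.
have -> : a = cls (rep a) by rewrite /cls /rep reprK.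
have cls_hcomp U' A' B' V C' D W' (t : term U' A' B' V) (s : term V C' D W') :
    cls (Thcomp t s) = @hcomp _ _ free_cornering _ _ _ _ _ _ _ (cls t) (cls s).
  by apply: fcellP => E; rewrite !fevalDE.
have cls_vcomp U' A' B' V C' D W' (t : term U' A' B' V) (s : term C' B' D W') :
    cls (Tvcomp t s) = @vcomp _ _ free_cornering _ _ _ _ _ _ _ (cls t) (cls s).
  by apply: fcellP => E; rewrite !fevalDE.
have cls_pair V U' W' A' B' (t : term V A' B' U') (s : term V A' B' W') :
    cls (Tpair t s) = @cpair _ free_cornering _ _ _ _ _ (cls t) (cls s).
  by apply: fcellP => E; rewrite !fevalDE.
have cls_choice U' W' V A' B' (t : term U' A' B' V) (s : term W' A' B' V) :
    cls (Tchoice t s) = @cchoice _ free_cornering _ _ _ _ _ (cls t) (cls s).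
  by apply: fcellP => E; rewrite !fevalDE.
have cls_case U' W' A' B' E' (t : term U' A' E' W') (s : term U' B' E' W') :
    cls (Tcocase t s) = @cocase _ free_cornering _ _ _ _ _ (cls t) (cls s).
  by apply: fcellP => E; rewrite !fevalDE.
rewrite [RHS]feval_cls; elim: {a}(rep a) => {U A B W} /=.
- by move=> U A B V A' B' W t IHt s IHs; rewrite cls_hcomp chom_hcomp IHt IHs.
- by move=> U A B V A' B' W t IHt s IHs; rewrite cls_vcomp chom_vcomp IHt IHs.
- exact: (chom_hid F).
- exact: (chom_vid F).
- exact: (chom_emb F).
- exact: (chom_getL F).
- exact: (chom_putR F).
- exact: (chom_getR F).
- exact: (chom_putL F).
- exact: (chom_pi0 F).
- exact: (chom_pi1 F).
- by move=> V U W A B t IHt s IHs; rewrite cls_pair chom_cpair IHt IHs.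
- exact: (chom_inn0 F).
- exact: (chom_inn1 F).
- by move=> U W V A B t IHt s IHs; rewrite cls_choice chom_cchoice IHt IHs.
- by move=> U W A B E t IHt s IHs; rewrite cls_case chom_cocase IHt IHs.
Qed.

Theorem free_cornering_initial (C : cornering M) :
  exists F : cornering_hom free_cornering C,
  forall G : cornering_hom free_cornering C,
  forall U A B W (a : free_cornering U A B W), G _ _ _ _ a = F _ _ _ _ a.
Proof. by exists (free_hom C) => G U A B W a; exact: free_hom_uniq. Qed.

End Free.

Arguments hcast {_ _ _ _ _ _ _ _ _} eA eB a.

Section Crossing.
Variables (M : distr_moncat) (C : cornering M) (B : M).

(* The casts identify \I \ox B and B \ox \I with B. *)
Fixpoint chi_letter (l : letter M) : C [:: l] B B [:: l] :=
  let fix chi_word (U : seq (letter M)) : C U B B U :=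
    match U return C U B B U with
    | [::] => vid C B
    | l' :: U' => vcomp (chi_letter l') (chi_word U')
    end in
  match l return C [:: l] B B [:: l] with
  | circ A =>
      hcast (mmul1 B) (mmulr1 B)
        (vcomp (hcomp (getL C A) (vid C B))
          (vcomp (emb C (braid A B))
            (hcomp (vid C B) (putR C A))))
  | bullet A =>
      hcast (mmulr1 B) (mmul1 B)
        (vcomp (hcomp (vid C B) (getR C A))
          (vcomp (emb C (braid B A))
            (hcomp (putL C A) (vid C B))))
  | ltimes U W =>
      cpair (hcast (mmul1 B) (mmul1 B) (hcomp (pi0 C U W) (chi_word U)))
            (hcast (mmul1 B) (mmul1 B) (hcomp (pi1 C U W) (chi_word W)))
  | lplus U W =>
      cchoice (hcast (mmulr1 B) (mmulr1 B) (hcomp (chi_word U) (inn0 C U W)))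
              (hcast (mmulr1 B) (mmulr1 B) (hcomp (chi_word W) (inn1 C U W)))
  end.

Fixpoint chi_word (U : seq (letter M)) : C U B B U :=
  match U return C U B B U with
  | [::] => vid C B
  | l :: U' => vcomp (chi_letter l) (chi_word U')
  end.

End Crossing.

Definition chi (M : distr_moncat) (C : cornering M) (U : exch M) (B : M) :
  C U B B U := chi_word C B U.

Section CrossingTheory.
Variables (M : distr_moncat) (C : cornering M) (B : M).

Lemma chi_cell1 l : chi C [:: l] B = chi_letter C B l.
Proof. exact: cell_eq_eq (vcompc1 (chi_letter C B l)). Qed.

Lemma chi_circ A :
  chi C (xcirc A) B =
  hcast (mmul1 B) (mmulr1 B)
    (vcomp (hcomp (getL C A) (vid C B))
      (vcomp (emb C (braid A B)) (hcomp (vid C B) (putR C A)))).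
Proof. exact: chi_cell1. Qed.

Lemma chi_bullet A :
  chi C (xbullet A) B =
  hcast (mmulr1 B) (mmul1 B)
    (vcomp (hcomp (vid C B) (getR C A))
      (vcomp (emb C (braid B A)) (hcomp (putL C A) (vid C B)))).
Proof. exact: chi_cell1. Qed.

Lemma chi_one : chi C \I B = vid C B.
Proof. by []. Qed.

Lemma chi_mul (U W : exch M) :
  chi C (U \ox W) B = vcomp (chi C U B) (chi C W B).
Proof.
elim: U => [|l U IHU]; first exact: esym (cell_eq_eq (vcomp1c (chi C W B))).
change (vcomp (chi_letter C B l) (chi C ((U : exch M) \ox W) B) =
  vcomp (vcomp (chi_letter C B l) (chi C U B)) (chi C W B)).
rewrite IHU.
exact: (cell_eq_eq (vcompA (chi_letter C B l) (chi C U B) (chi C W B))).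
Qed.

Lemma chi_plus U W :
  chi C (xplus U W) B =
  cchoice (hcast (mmulr1 B) (mmulr1 B) (hcomp (chi C U B) (inn0 C U W)))
          (hcast (mmulr1 B) (mmulr1 B) (hcomp (chi C W B) (inn1 C U W))).
Proof. exact: chi_cell1. Qed.

Lemma chi_times U W :
  chi C (xtimes U W) B =
  cpair (hcast (mmul1 B) (mmul1 B) (hcomp (pi0 C U W) (chi C U B)))
        (hcast (mmul1 B) (mmul1 B) (hcomp (pi1 C U W) (chi C W B))).
Proof. exact: chi_cell1. Qed.

End CrossingTheory.

(* Main.v *)
(* Both identities hold in every cornering, by induction on [U]. In the case of
   a tensor they are interchange. In the cases of [U + W] and [U x W] they follow
   from uniqueness of copairing and pairing, since a projection or injection that
   slides past two crossings slides past their composite. In the case of [K°],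
   the put of the left crossing meets the get of the right crossing in the middle
   row of [chi A | chi B] and cancels by a yanking equation, leaving
   [(braid K A | 1) ; (1 | braid K B)], which the hexagon identifies with
   [braid K (A \ox B)]; [K•] is the mirror image. For the unit, [braid K \I] is
   an identity. *)
From mathcomp Require Import all_boot.
Require Import Defs.

Local Open Scope mon_scope.

Set Implicit Arguments.
Unset Strict Implicit.
Unset Printing Implicit Defensive.

(** * Equality of cells across fibres *)

Section CellEq.
Variables (V H : Type) (cell : V -> H -> H -> V -> Type).

Lemma cell_eq_sym U A B W U' A' B' W' (a : cell U A B W)
    (b : cell U' A' B' W') : a =~ b -> b =~ a.
Proof. by case. Qed.

Lemma cell_eq_trans U A B W U' A' B' W' U'' A'' B'' W'' (a : cell U A B W)
    (b : cell U' A' B' W') (c : cell U'' A'' B'' W'') :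
  a =~ b -> b =~ c -> a =~ c.
Proof. by move=> ab; case. Qed.

Lemma cell_eq_bounds U A B W U' A' B' W' (a : cell U A B W)
    (b : cell U' A' B' W') :
  a =~ b -> [/\ U = U', A = A', B = B' & W = W'].
Proof. by case. Qed.

End CellEq.

(** * Congruence, units and interchange up to reindexing *)

Section DoubleCat.
Variables (H V : monoid) (D : double_cat H V).

Lemma hcast_eq U A B W A' B' (eA : A = A') (eB : B = B') (a : D U A B W) :
  hcast eA eB a =~ a.
Proof. by case: _ / eA; case: _ / eB. Qed.

(** The boundaries are identified first, so that both hypotheses fall into a single fibre, where
    [cell_eq_eq] turns them into plain equalities. *)
Lemma eq_hcomp U A B X C E W U' A' B' X' C' E' W'
    (a : D U A B X) (b : D X C E W) (a' : D U' A' B' X') (b' : D X' C' E' W') :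
  a =~ a' -> b =~ b' -> hcomp a b =~ hcomp a' b'.
Proof.
move=> ea eb.
case: (cell_eq_bounds ea) (cell_eq_bounds eb) => eU eA eB eX [_ eC eE eW].
case: _ / eU in a' ea *; case: _ / eA in a' ea *; case: _ / eB in a' ea *.
case: _ / eX in a' b' ea eb *; case: _ / eC in b' eb *.
case: _ / eE in b' eb *; case: _ / eW in b' eb *.
by rewrite (cell_eq_eq ea) (cell_eq_eq eb).
Qed.

Lemma eq_vcomp U A B W X C Y U' A' B' W' X' C' Y'
    (a : D U A B W) (b : D X B C Y) (a' : D U' A' B' W') (b' : D X' B' C' Y') :
  a =~ a' -> b =~ b' -> vcomp a b =~ vcomp a' b'.
Proof.
move=> ea eb.
case: (cell_eq_bounds ea) (cell_eq_bounds eb) => eU eA eB eW [eX _ eC eY].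
case: _ / eU in a' ea *; case: _ / eA in a' ea *; case: _ / eW in a' ea *.
case: _ / eB in a' b' ea eb *; case: _ / eC in b' eb *.
case: _ / eX in b' eb *; case: _ / eY in b' eb *.
by rewrite (cell_eq_eq ea) (cell_eq_eq eb).
Qed.

(** [E] is kept apart from [A] and [B] because cancelling corners or braidings gives an identity on
    an object that is only provably equal to their boundaries. *)
Lemma vcomp_vidl A B E (x : D \I A B \I) U C W (y : D U B C W) :
  x =~ vid D E -> vcomp x y =~ y.
Proof.
move=> ex; apply: cell_eq_trans (vcomp1c y); apply: eq_vcomp => //.
case: (cell_eq_bounds ex) => _ _ eB _.
by case: _ / eB ex.
Qed.

Lemma vcomp_vidr A B E (x : D \I A B \I) U C W (y : D U C A W) :
  x =~ vid D E -> vcomp y x =~ y.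
Proof.
move=> ex; apply: cell_eq_trans (vcompc1 y); apply: eq_vcomp => //.
case: (cell_eq_bounds ex) => _ eA _ _.
by case: _ / eA ex.
Qed.

Lemma hcomp1v A B W (a : D \I A B W) : hcomp (vid D \I) a =~ a.
Proof. by rewrite -hid_one; exact: hcomp1c. Qed.

Lemma hcompv1 U A B (a : D U A B \I) : hcomp a (vid D \I) =~ a.
Proof. by rewrite -hid_one; exact: hcompc1. Qed.

Lemma hcomp_vid A B A1 A2 B1 B2 (x : D \I A1 A2 \I) (y : D \I B1 B2 \I) :
  x =~ vid D A -> y =~ vid D B -> hcomp x y =~ vid D (A \ox B).
Proof. by move=> ex ey; rewrite vid_mul; apply: eq_hcomp. Qed.

Lemma vid_eq A B : A = B -> vid D A =~ vid D B.
Proof. by move->. Qed.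

(** Five is the number of rows when two three-row cells overlap in one row. *)
Lemma interchange5 A0 A1 A2 A3 A4 A5 B0 B1 B2 B3 B4 B5
    U1 U2 U3 U4 U5 X1 X2 X3 X4 X5 W1 W2 W3 W4 W5
    (a1 : D U1 A0 A1 X1) (a2 : D U2 A1 A2 X2) (a3 : D U3 A2 A3 X3)
    (a4 : D U4 A3 A4 X4) (a5 : D U5 A4 A5 X5)
    (b1 : D X1 B0 B1 W1) (b2 : D X2 B1 B2 W2) (b3 : D X3 B2 B3 W3)
    (b4 : D X4 B3 B4 W4) (b5 : D X5 B4 B5 W5) :
  hcomp (vcomp a1 (vcomp a2 (vcomp a3 (vcomp a4 a5))))
        (vcomp b1 (vcomp b2 (vcomp b3 (vcomp b4 b5)))) =
  vcomp (hcomp a1 b1) (vcomp (hcomp a2 b2) (vcomp (hcomp a3 b3)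
    (vcomp (hcomp a4 b4) (hcomp a5 b5)))).
Proof. by rewrite !interchange. Qed.

(* The first cell hands its boundary [W] over to the second one in the middle
   row, where the two corners cancel. *)
Lemma staircase_lr A0 A1 A2 A3 B0 B1 B2 B3 E U W X
    (a1 : D U A0 A1 \I) (a2 : D \I A1 A2 \I) (a3 : D \I A2 A3 W)
    (b1 : D W B0 B1 \I) (b2 : D \I B1 B2 \I) (b3 : D \I B2 B3 X)
    (eE : A3 \ox B1 = A2 \ox B0) U' A A' B B' W' X'
    (x : D U' A A' W') (y : D W' B B' X') :
  x =~ vcomp a1 (vcomp a2 a3) -> y =~ vcomp b1 (vcomp b2 b3) ->
  hcomp a3 b1 =~ vid D E ->
  hcomp x y =~ vcomp (hcomp a1 (vid D B0))
    (vcomp (vcomp (hcomp a2 (vid D B0)) (hcast eE erefl (hcomp (vid D A3) b2)))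
           (hcomp (vid D A3) b3)).
Proof.
move=> ex ey e.
(* Two identity rows below [x] and two above [y] align the last row of [x] with the first row of
   [y]. *)
have ex' : x =~ vcomp a1 (vcomp a2 (vcomp a3 (vcomp (vid D A3) (vid D A3)))).
  apply: cell_eq_trans ex _; do 2!apply: eq_vcomp => //.
  apply: cell_eq_sym; apply: cell_eq_trans (vcompc1 a3).
  by apply: eq_vcomp => //; exact: vcomp1c.
have ey' : y =~ vcomp (vid D B0) (vcomp (vid D B0) (vcomp b1 (vcomp b2 b3))).
  apply: cell_eq_trans ey _; apply: cell_eq_sym.
  by apply: cell_eq_trans (vcomp1c _) _; exact: vcomp1c.
apply: cell_eq_trans (eq_hcomp ex' ey') _.
rewrite interchange5; apply: eq_vcomp => //.
apply: cell_eq_trans (vcompA _ _ _); apply: eq_vcomp => //.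
apply: cell_eq_trans (vcomp_vidl _ e) _; apply: eq_vcomp => //.
by apply: cell_eq_sym; exact: hcast_eq.
Qed.

(** Mirror image of [staircase_lr]: the right cell comes first, and its last row meets the first row
    of the left one. *)
Lemma staircase_rl A0 A1 A2 A3 B0 B1 B2 B3 E U W X
    (a1 : D \I A0 A1 W) (a2 : D \I A1 A2 \I) (a3 : D U A2 A3 \I)
    (b1 : D \I B0 B1 X) (b2 : D \I B1 B2 \I) (b3 : D W B2 B3 \I)
    (eE : A0 \ox B2 = A1 \ox B3) U' A A' B B' W' X'
    (x : D U' A A' W') (y : D W' B B' X') :
  x =~ vcomp a1 (vcomp a2 a3) -> y =~ vcomp b1 (vcomp b2 b3) ->
  hcomp a1 b3 =~ vid D E ->
  hcomp x y =~ vcomp (hcomp (vid D A0) b1)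
    (vcomp (vcomp (hcast erefl eE (hcomp (vid D A0) b2)) (hcomp a2 (vid D B3)))
           (hcomp a3 (vid D B3))).
Proof.
move=> ex ey e.
have ey' : y =~ vcomp b1 (vcomp b2 (vcomp b3 (vcomp (vid D B3) (vid D B3)))).
  apply: cell_eq_trans ey _; do 2!apply: eq_vcomp => //.
  apply: cell_eq_sym; apply: cell_eq_trans (vcompc1 b3).
  by apply: eq_vcomp => //; exact: vcomp1c.
have ex' : x =~ vcomp (vid D A0) (vcomp (vid D A0) (vcomp a1 (vcomp a2 a3))).
  apply: cell_eq_trans ex _; apply: cell_eq_sym.
  by apply: cell_eq_trans (vcomp1c _) _; exact: vcomp1c.
apply: cell_eq_trans (eq_hcomp ex' ey') _.
rewrite interchange5; apply: eq_vcomp => //.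
apply: cell_eq_trans (vcompA _ _ _); apply: eq_vcomp.
  by apply: cell_eq_sym; exact: hcast_eq.
exact: vcomp_vidl e.
Qed.

(** Associativity brings [p] next to [y], then next to [x]. Both projections and injections are
    instances of [p]. *)
Lemma hcomp_slide U W A A' B B' (p : D U \I \I W) (x : D U A A' U)
    (x' : D W A A' W) (y : D U B B' U) (y' : D W B B' W) :
  hcomp x p =~ hcomp p x' -> hcomp y p =~ hcomp p y' ->
  hcomp (hcomp x y) p =~ hcomp p (hcomp x' y').
Proof.
move=> ex ey.
apply: cell_eq_trans (cell_eq_sym (hcompA x y p)) _.
apply: cell_eq_trans (eq_hcomp (CellEq x) ey) _.
apply: cell_eq_trans (hcompA x p y') _.
apply: cell_eq_trans (eq_hcomp ex (CellEq y')) _.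
exact: cell_eq_sym (hcompA p x' y').
Qed.

End DoubleCat.

(** The generated principle for [letter] gives no hypothesis on the words stored in a letter. Here
    the recursion on letters is explicit: each stored word is traversed by list induction, and its
    letters go to the outer call [IH]. *)
Lemma exch_ind (O : Type) (P : exch O -> Prop) :
  P \I -> (forall U W, P U -> P W -> P (U \ox W)) ->
  (forall A, P (xcirc A)) -> (forall A, P (xbullet A)) ->
  (forall U W, P U -> P W -> P (xtimes U W)) ->
  (forall U W, P U -> P W -> P (xplus U W)) ->
  forall U, P U.
Proof.
move=> P1 PM Pc Pb Pt Pp.
pose word (IH : forall l, P [:: l]) :=
  fix word (U : seq (letter O)) : P U :=
    match U with
    | [::] => P1
    | l :: U' => PM [:: l] U' (IH l) (word U')
    end.
apply: word; fix IH 1 => -[A|A|U W|U W].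
- exact: Pc.
- exact: Pb.
- by apply: Pt; [elim: U => [|l U IHU] | elim: W => [|l W IHW]] => //;
    apply: (PM [:: l]).
- by apply: Pp; [elim: U => [|l U IHU] | elim: W => [|l W IHW]] => //;
    apply: (PM [:: l]).
Qed.

(** * Unit and hexagon laws for embedded braidings *)

Section Cornering.
Variables (M : distr_moncat) (C : cornering M).
Implicit Types (A B K : ob M) (U W : exch M).

Lemma emb_eq A B A' B' (f : hom A B) (g : hom A' B') :
  f =~h g -> emb C f =~ emb C g.
Proof. by case. Qed.

Lemma emb_cast A B A' B' (eA : A = A') (eB : B = B') (f : hom A B) :
  emb C (hom_cast eA eB f) =~ emb C f.
Proof. by case: _ / eA; case: _ / eB. Qed.

Lemma braidK A B :
  vcomp (emb C (braid A B)) (emb C (braid B A)) =~ vid C (A \ox B).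
Proof.
by apply: cell_eq_trans (cell_eq_sym (emb_comp C _ _)) _;
  rewrite braid_sym emb_id.
Qed.

Lemma emb_hexagon K A B :
  emb C (braid K (A \ox B)) =~
  vcomp (hcomp (emb C (braid K A)) (vid C B))
        (hcast (mmulA A K B) (mmulA A B K)
           (hcomp (vid C A) (emb C (braid K B)))).
Proof.
apply: cell_eq_trans (emb_eq (braid_hexagon K A B)) _.
apply: cell_eq_trans (emb_comp C _ _) _; apply: eq_vcomp.
  by rewrite emb_tens emb_id.
apply: cell_eq_trans (emb_cast _ _ _) _.
by rewrite emb_tens emb_id; apply: cell_eq_sym; exact: hcast_eq.
Qed.

(* Cancelling the invertible [braid A \I] in the hexagon for [A, \I, \I]. *)
Lemma emb_braidr1 A : emb C (braid A \I) =~ vid C A.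
Proof.
pose S1 := hcomp (emb C (braid A \I)) (vid C \I).
pose T1 := hcomp (emb C (braid \I A)) (vid C \I).
have := emb_hexagon A \I \I.
set Z := hcast _ _ _ => hex.
have ZS : Z =~ emb C (braid A \I).
  by apply: cell_eq_trans (hcast_eq _ _ _) _; exact: hcomp1v.
have TS : vcomp T1 S1 =~ vid C (\I \ox A \ox \I).
  rewrite /T1 /S1 -interchange.
  by apply: hcomp_vid (braidK \I A) _; exact: vcomp1c.
apply: cell_eq_trans (cell_eq_sym ZS) _.
apply: cell_eq_trans (cell_eq_sym (vcomp_vidl Z TS)) _.
apply: cell_eq_trans (cell_eq_sym (vcompA T1 S1 Z)) _.
(* By the hexagon, [vcomp S1 Z] is the braiding of [A] with [\I \ox \I], which is [S1] up to
   units. *)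
apply: (cell_eq_trans (b := vcomp T1 S1)).
  apply: eq_vcomp => //.
  apply: cell_eq_trans (cell_eq_sym hex) _.
  apply: cell_eq_trans (cell_eq_sym (hcompv1 _)).
  by rewrite mmul1.
apply: cell_eq_trans TS _; apply: vid_eq.
by rewrite mmulr1 mmul1.
Qed.

(** By symmetry this cell is inverse to the braiding of [A] with [\I], already known to be an
    identity. *)
Lemma emb_braidl1 A : emb C (braid \I A) =~ vid C A.
Proof.
have e := cell_eq_sym (vcomp_vidr (emb C (braid \I A)) (emb_braidr1 A)).
apply: cell_eq_trans e _; apply: cell_eq_trans (braidK _ _) _.
by apply: vid_eq; rewrite mmul1.
Qed.

(* The inverse of the hexagon, by uniqueness of inverses. *)
Lemma emb_hexagonV A B K :
  emb C (braid (A \ox B) K) =~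
  vcomp (hcast (mmulA A B K) (mmulA A K B)
           (hcomp (vid C A) (emb C (braid B K))))
        (hcomp (emb C (braid A K)) (vid C B)).
Proof.
set q1 := hcast _ _ _; set q2 := hcomp _ (vid C B).
pose r1 := hcomp (emb C (braid K A)) (vid C B).
pose r2 := hcast (mmulA A K B) (mmulA A B K)
             (hcomp (vid C A) (emb C (braid K B))).
pose r := vcomp r1 r2; pose q := vcomp q1 q2.
(* [r] is the hexagon for [braid K (A \ox B)]; the factors of [q] undo those of [r], innermost pair
   first. *)
have rq : vcomp r q =~ vid C (K \ox A \ox B).
  apply: cell_eq_trans (cell_eq_sym (vcompA r1 r2 q)) _.
  have r1q2 : vcomp r1 q2 =~ vid C (K \ox A \ox B).
    rewrite /r1 /q2 -interchange.
    by apply: hcomp_vid (braidK K A) _; exact: vcomp1c.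
  have r2q1 : vcomp r2 q1 =~ vid C (A \ox (K \ox B)).
    apply: (cell_eq_trans (b := vcomp (hcomp (vid C A) (emb C (braid K B)))
             (hcomp (vid C A) (emb C (braid B K))))).
      by apply: eq_vcomp; exact: hcast_eq.
    rewrite -interchange.
    by apply: hcomp_vid (braidK K B); exact: vcomp1c.
  apply: cell_eq_trans r1q2; apply: eq_vcomp => //.
  apply: cell_eq_trans (vcompA r2 q1 q2) _.
  exact: vcomp_vidl r2q1.
(* Rebracketing the bottom of the braiding lets it be stacked on [r]; then p = p(rq) = (pr)q = q. *)
pose p := hcast (erefl (A \ox B \ox K)) (mmulA K A B)
  (emb C (braid (A \ox B) K)).
have pE : p =~ emb C (braid (A \ox B) K) by exact: hcast_eq.
have pr : vcomp p r =~ vid C (A \ox B \ox K).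
  apply: cell_eq_trans (braidK (A \ox B) K); apply: eq_vcomp => //.
  by apply: cell_eq_sym; exact: emb_hexagon.
apply: cell_eq_trans (cell_eq_sym pE) _.
apply: cell_eq_trans (cell_eq_sym (vcomp_vidr p rq)) _.
apply: cell_eq_trans (vcompA p r q) _.
exact: vcomp_vidl pr.
Qed.

(** * Crossings of the letters K° and K• *)

Lemma chi_circ_tens K A B :
  chi C (xcirc K) (A \ox B) =~ hcomp (chi C (xcirc K) A) (chi C (xcirc K) B).
Proof.
have eE : A \ox \I \ox (K \ox B) = A \ox K \ox (\I \ox B).
  by rewrite mmulr1 mmul1 mmulA.
have e : hcomp (hcomp (vid C A) (putR C K)) (hcomp (getL C K) (vid C B)) =~
    vid C (A \ox (K \ox B)).
  apply: cell_eq_trans (cell_eq_sym (hcompA _ _ _)) _.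
  apply: hcomp_vid => //; apply: cell_eq_trans (hcompA _ _ _) _.
  by apply: hcomp_vid => //; exact: putR_getL_h.
have chiE B0 : chi C (xcirc K) B0 =~
    vcomp (hcomp (getL C K) (vid C B0))
      (vcomp (emb C (braid K B0)) (hcomp (vid C B0) (putR C K))).
  by rewrite chi_circ; exact: hcast_eq.
apply: cell_eq_trans (cell_eq_sym (staircase_lr eE (chiE A) (chiE B) e)).
(* The comparison is now row by row: the outer rows agree by splitting [vid] of a tensor, the middle
   ones by the hexagon. *)
apply: cell_eq_trans (chiE _) _; apply: eq_vcomp.
  apply: cell_eq_trans (hcompA _ _ _); apply: eq_hcomp => //.
  by rewrite vid_mul mmul1.
apply: eq_vcomp; last first.
  apply: cell_eq_trans (cell_eq_sym (hcompA _ _ _)); apply: eq_hcomp => //.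
  by rewrite -vid_mul mmulr1.
apply: cell_eq_trans (emb_hexagon K A B) _; apply: eq_vcomp.
  by apply: eq_hcomp => //; rewrite mmul1.
apply: cell_eq_trans (hcast_eq _ _ _) _; apply: cell_eq_sym.
apply: cell_eq_trans (hcast_eq _ _ _) _.
by apply: eq_hcomp => //; rewrite mmulr1.
Qed.

(** A [bullet] wire runs from right to left, so the right crossing acts first and [A \ox B] is
    braided past [K]; hence [staircase_rl] and [emb_hexagonV]. *)
Lemma chi_bullet_tens K A B :
  chi C (xbullet K) (A \ox B) =~
  hcomp (chi C (xbullet K) A) (chi C (xbullet K) B).
Proof.
have eE : A \ox \I \ox (K \ox B) = A \ox K \ox (\I \ox B).
  by rewrite mmulr1 mmul1 mmulA.
have e : hcomp (hcomp (vid C A) (getR C K)) (hcomp (putL C K) (vid C B)) =~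
    vid C (A \ox (K \ox B)).
  apply: cell_eq_trans (cell_eq_sym (hcompA _ _ _)) _.
  apply: hcomp_vid => //; apply: cell_eq_trans (hcompA _ _ _) _.
  by apply: hcomp_vid => //; exact: getR_putL_h.
have chiE B0 : chi C (xbullet K) B0 =~
    vcomp (hcomp (vid C B0) (getR C K))
      (vcomp (emb C (braid B0 K)) (hcomp (putL C K) (vid C B0))).
  by rewrite chi_bullet; exact: hcast_eq.
apply: cell_eq_trans (cell_eq_sym (staircase_rl eE (chiE A) (chiE B) e)).
apply: cell_eq_trans (chiE _) _; apply: eq_vcomp.
  apply: cell_eq_trans (cell_eq_sym (hcompA _ _ _)); apply: eq_hcomp => //.
  by rewrite -vid_mul mmulr1.
apply: eq_vcomp; last first.
  apply: cell_eq_trans (hcompA _ _ _); apply: eq_hcomp => //.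
  by rewrite vid_mul mmul1.
apply: cell_eq_trans (emb_hexagonV A B K) _; apply: eq_vcomp.
  apply: cell_eq_trans (hcast_eq _ _ _) _; apply: cell_eq_sym.
  apply: cell_eq_trans (hcast_eq _ _ _) _.
  by apply: eq_hcomp => //; rewrite mmulr1.
by apply: eq_hcomp => //; rewrite mmul1.
Qed.

(** At the unit the braiding row disappears, and get above put is the vertical yanking equation. *)
Lemma chi_one_circ K : chi C (xcirc K) \I =~ hid C (xcirc K).
Proof.
rewrite chi_circ; apply: cell_eq_trans (hcast_eq _ _ _) _.
have eL := hcompv1 (getL C K).
have eR := vcomp_vidl (hcomp (vid C \I) (putR C K)) (emb_braidr1 K).
have {}eR := cell_eq_trans eR (hcomp1v (putR C K)).
exact: cell_eq_trans (eq_vcomp eL eR) (getL_putR_v C K).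
Qed.

Lemma chi_one_bullet K : chi C (xbullet K) \I =~ hid C (xbullet K).
Proof.
rewrite chi_bullet; apply: cell_eq_trans (hcast_eq _ _ _) _.
have eL := hcomp1v (getR C K).
have eR := vcomp_vidl (hcomp (putL C K) (vid C \I)) (emb_braidl1 K).
have {}eR := cell_eq_trans eR (hcompv1 (putL C K)).
exact: cell_eq_trans (eq_vcomp eL eR) (getR_putL_v C K).
Qed.

(** * The two identities, by induction on exchanges *)

Lemma chi_unit U : chi C U \I = hid C U.
Proof.
elim/exch_ind: U => [|U W IHU IHW|K|K|U W IHU IHW|U W IHU IHW].
- by rewrite chi_one hid_one.
- by rewrite chi_mul IHU IHW -hid_mul.
- exact: cell_eq_eq (chi_one_circ K).
- exact: cell_eq_eq (chi_one_bullet K).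
(* It suffices that [hid] satisfies the equations characterising the pairing; both sides reduce to
   the projection. *)
- rewrite chi_times IHU IHW; apply: esym; apply: cpair_uniq;
    apply: cell_eq_trans (hcomp1c _) _; apply: cell_eq_sym;
    apply: cell_eq_trans (hcast_eq _ _ _) _; exact: hcompc1.
- rewrite chi_plus IHU IHW; apply: esym; apply: cchoice_uniq;
    apply: cell_eq_trans (hcompc1 _) _; apply: cell_eq_sym;
    apply: cell_eq_trans (hcast_eq _ _ _) _; exact: hcomp1c.
Qed.

Lemma chi_tens U A B : chi C U (A \ox B) = hcomp (chi C U A) (chi C U B).
Proof.
elim/exch_ind: U => [|U W IHU IHW|K|K|U W IHU IHW|U W IHU IHW].
- by rewrite !chi_one vid_mul.
- by rewrite !chi_mul IHU IHW interchange.
- exact: cell_eq_eq (chi_circ_tens K A B).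
- exact: cell_eq_eq (chi_bullet_tens K A B).
- rewrite (chi_times C (A \ox B)) IHU IHW; apply: esym; apply: cpair_uniq;
    apply: cell_eq_trans (cell_eq_sym (hcast_eq _ _ _));
    (* For a single crossing, sliding past a projection is the defining equation of [cpair]. *)
    apply: hcomp_slide; rewrite chi_times;
    first [exact: cell_eq_trans (cpair0 _ _) (hcast_eq _ _ _)
          |exact: cell_eq_trans (cpair1 _ _) (hcast_eq _ _ _)].
- rewrite (chi_plus C (A \ox B)) IHU IHW; apply: esym; apply: cchoice_uniq;
    apply: cell_eq_trans (cell_eq_sym (hcast_eq _ _ _));
    (* Injections enter from the left, so the slide is used in the reverse direction. *)
    apply: cell_eq_sym; apply: hcomp_slide; rewrite chi_plus; apply: cell_eq_sym;
    first [exact: cell_eq_trans (cchoice0 _ _) (hcast_eq _ _ _)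
          |exact: cell_eq_trans (cchoice1 _ _) (hcast_eq _ _ _)].
Qed.

End Cornering.

Theorem lemma11 (M : distr_moncat) (U : exch (ob M)) (A B : ob M) :
  chi (free_cornering M) U (A \ox B) =
    hcomp (chi (free_cornering M) U A) (chi (free_cornering M) U B) /\
  chi (free_cornering M) U \I = hid (free_cornering M) U.
Proof. by split; [exact: chi_tens | exact: chi_unit]. Qed.
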